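(* Let $g=(g^1,\dots,g^m):[0,T]\to\mathbb{R}^m$ be Hölder continuous of order $\beta>1/2$. Let $\gamma^1,\dots,\gamma^p$ be multi-indices in $\Gamma$, $r=|\gamma^1|+\cdots+|\gamma^p|$, $\tau_i=|\gamma^1|+\cdots+|\gamma^i|$ for $i=1,\dots,p$, and let $\gamma=(\gamma^1,\dots,\gamma^p)\in\Gamma_r$ be the concatenation. Then for $0\le\tau\le s\le T$ $$\int_\tau^s\int_\tau^{s_p}\cdots\int_\tau^{s_2}dg^{\gamma^1}_{\tau,s_1}\cdots dg^{\gamma^{p-1}}_{\tau,s_{p-1}}\,dg^{\gamma^p}_{\tau,s_p}=\sum_{\rho\in\Xi_r(\tau_1,\dots,\tau_p)}g^{\gamma\circ\rho^{-1}}_{\tau,s}.$$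
   Context: $\Gamma_r$ is the set of multi-indices of length $r$ with entries in $\{1,\dots,m\}$, $\Gamma=\bigcup_{r\ge1}\Gamma_r$, $|\gamma|$ is the length. For $\alpha\in\Gamma_r$, $g^\alpha_{\tau,s}=\int_\tau^s\int_\tau^{s_r}\cdots\int_\tau^{s_2}dg^{\alpha_1}_{s_1}\cdots dg^{\alpha_r}_{s_r}$ (iterated Riemann–Stieltjes integral), and its differential is $dg^\alpha_{\tau,s}=\big(\int_\tau^s\cdots\int_\tau^{s_2}dg^{\alpha_1}_{s_1}\cdots dg^{\alpha_{r-1}}_{s_{r-1}}\big)dg^{\alpha_r}_s$. For a permutation $\sigma$ of $\{1,\dots,r\}$, $\alpha\circ\sigma=(\alpha_{\sigma(1)},\dots,\alpha_{\sigma(r)})$. With $\tau_0=0$, $\Xi_r(\tau_1,\dots,\tau_p)$ is the set of permutations $\rho$ of $\{1,\dots,r\}$ such that $\rho(\tau_i)<\rho(\tau_j)$ for $i<j$, and $\rho$ is increasing on each block $\{\tau_{i-1}+1,\dots,\tau_i\}$, $i=1,\dots,p$. *)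

(* Defs.v *)
From mathcomp Require Import all_boot all_order all_algebra all_fingroup.
From mathcomp Require Import all_classical all_reals all_analysis.

Set Implicit Arguments.
Unset Strict Implicit.
Unset Printing Implicit Defensive.

Import Order.TTheory GRing.Theory Num.Theory.
Import numFieldNormedType.Exports.

Local Open Scope classical_set_scope.
Local Open Scope ring_scope.

(* A partition a = x_0 < x_1 < ... < x_n = b is given, as in [itv_partition],
   by the sequence s = [:: x_1; ...; x_n]; [part_pt a s i] is x_i. *)
Definition part_pt (R : realType) (a : R) (s : seq R) (i : nat) : R :=
  nth a (a :: s) i.

Definition mesh_lt (R : realType) (a : R) (s : seq R) (d : R) : Prop :=
  forall i, (i < size s)%N -> part_pt a s i.+1 - part_pt a s i < d.

Definition is_tagging (R : realType) (a : R) (s : seq R) (t : nat -> R) : Prop :=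
  forall i, (i < size s)%N -> part_pt a s i <= t i <= part_pt a s i.+1.

Definition RS_sum (R : realType) (f g : R -> R) (a : R) (s : seq R)
    (t : nat -> R) : R :=
  \sum_(0 <= i < size s) f (t i) * (g (part_pt a s i.+1) - g (part_pt a s i)).

Definition is_RSint (R : realType) (f g : R -> R) (a b I : R) : Prop :=
  forall e : R, 0 < e -> exists2 d : R, 0 < d &
    forall (s : seq R) (t : nat -> R),
      itv_partition a b s -> mesh_lt a s d -> is_tagging a s t ->
      `|RS_sum f g a s t - I| < e.

(* The Riemann-Stieltjes integral of f against dg over [a, b], for a <= b;
   its value is 0 by convention when the integral does not exist. *)
Definition RSint (R : realType) (f g : R -> R) (a b : R) : R :=
  xget 0 [set I | is_RSint f g a b I].

Definition hoelder_on (R : realType) (V : normedZmodType R) (beta T : R)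
    (g : R -> V) : Prop :=
  exists C : R, forall x y : R, 0 <= x <= T -> 0 <= y <= T ->
    `|g x - g y| <= C * `|x - y| `^ beta.

(* g^alpha_{tau,s}; [foldl] reads alpha from alpha_1, the innermost
   differential, to alpha_r, the outermost one.  The empty word gives 1. *)
Definition iter_int (R : realType) (m : nat) (g : R -> 'rV[R]_m) (tau : R)
    (alpha : seq 'I_m) : R -> R :=
  foldl (fun (F : R -> R) (i : 'I_m) (s : R) =>
           RSint F (fun u => g u 0 i) tau s)
        (fun=> 1) alpha.

(* s |-> the integral over [tau, s] of F against dg^alpha_{tau,u}, where
   dg^alpha_{tau,u} = g^(alpha_1,...,alpha_(r-1))_{tau,u} dg^(alpha_r)_u.
   For alpha = i :: w, belast i w is alpha without its last entry last i w. *)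
Definition int_diff (R : realType) (m : nat) (g : R -> 'rV[R]_m) (tau : R)
    (F : R -> R) (alpha : seq 'I_m) (s : R) : R :=
  if alpha is i :: w then
    RSint (fun u => F u * iter_int g tau (belast i w) u)
          (fun u => g u 0 (last i w)) tau s
  else 0.

Definition iter_int_diff (R : realType) (m : nat) (g : R -> 'rV[R]_m) (tau : R)
    (gammas : seq (seq 'I_m)) : R -> R :=
  foldl (int_diff g tau) (fun=> 1) gammas.

Definition total_length (m : nat) (gammas : seq (seq 'I_m)) : nat :=
  sumn (shape gammas).

Definition concat (m : nat) (gammas : seq (seq 'I_m)) :
    (total_length gammas).-tuple 'I_m :=
  Tuple (introT eqP (size_flatten gammas)).

(* tau_i = |gamma^1| + ... + |gamma^i|, so tau_0 = 0. *)
Definition block_end (m : nat) (gammas : seq (seq 'I_m)) (i : nat) : nat :=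
  sumn (take i (shape gammas)).

(* The position k of {1, ..., r} is the ordinal of 'I_r of value k - 1. *)
Definition Xi (r p : nat) (tau : nat -> nat) : {set {perm 'I_r}} :=
  [set rho : {perm 'I_r} |
    `[< (forall (i j : nat) (k l : 'I_r), (1 <= i)%N -> (i < j <= p)%N ->
           k.+1 = tau i -> l.+1 = tau j -> (rho k < rho l)%N) /\
        (forall (i : nat) (k l : 'I_r), (1 <= i <= p)%N ->
           (tau i.-1 < k.+1)%N -> (k < l)%N -> (l.+1 <= tau i)%N ->
           (rho k < rho l)%N) >]]%SET.

Definition perm_index (m r : nat) (alpha : r.-tuple 'I_m) (sigma : {perm 'I_r}) :
    r.-tuple 'I_m :=
  [tuple tnth alpha (sigma k) | k < r].

(* Main.v *)
Require Import Defs.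
From mathcomp Require Import all_boot all_order all_algebra all_fingroup.
From mathcomp Require Import all_classical all_reals all_analysis.
From mathcomp Require Import ring lra.

(** The identity splits into an analytic half and an order-theoretic half.

    Analysis.  On [a, b], every F met here is controlled by a germ: a
    two-point function A with F v - F u = A u v + O((v - u)^theta), theta > 1.
    Since theta > 1, the errors summed along a fine partition vanish, so a germ
    and an initial value determine F ([germ_unique]).  Conversely, a two-point
    function that is additive up to O((w - u)^theta) is the germ of some F
    ([sewing]).  For f, g Hoelder of order beta > 1/2 the germ
    f u * (g v - g u) is additive in this sense with theta = 2 beta, and the
    resulting F is the Riemann-Stieltjes integral ([RSint_young]).  Germs make
    the calculus of these integrals immediate: they add, and the product rule
    d(FG) = G dF + F dG holds because the cross term is the product of two
    increments of order beta ([germM]).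

    Order.  For a strict order on the positions of a word, call Phi(S) the sum,
    over the linear extensions of a set S of positions, of the iterated
    integral of the word read in that order ([order_sum]).  Sorting the linear
    extensions by their last element x, which is maximal in S, gives
    d Phi(S) = sum_x Phi(S - x) dg^x ([order_sum_germ]).  By the product rule
    and uniqueness, Phi(S1 u S2) = Phi(S1) Phi(S2) when no element of S1 is
    comparable with one of S2 ([order_sum_cat]); for two chains this is the
    shuffle product.

    The permutations in Xi are the linear extensions of the order in which
    each block is a chain and the block ends are a chain ([Xi_before]).  The
    last position c of the first q + 1 blocks is their unique maximal element.
    Once it is removed, the remainder of block q + 1 is a chain, incomparable
    with the first q blocks, so d Phi is the product of Phi(first q blocks), of
    the iterated integral of the shortened block, and of dg^c.  That is
    Phi(first q blocks) dg^(gamma^(q+1)), the recursion which defines the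
    left-hand side ([iter_int_diff_order_sum]). *)
Set Implicit Arguments.
Unset Strict Implicit.
Unset Printing Implicit Defensive.

Import Order.TTheory GRing.Theory Num.Theory.
Import numFieldNormedType.Exports.
Local Open Scope ring_scope.

(** * The sewing inequality *)

Section Powers.
Variables (R : realType) (theta : R).
Hypothesis theta1 : 1 < theta.

(** Trades the exponent theta > 1 for a factor linear in x, which telescopes
    along a partition, times a power of the mesh, which tends to 0. *)
Lemma powR_le_mesh (x h : R) : 0 <= x <= h ->
  x `^ theta <= h `^ (theta - 1) * x.
Proof.
move=> /andP[x0 xh]; rewrite -mulr_powRB1 ?(lt_trans ltr01)// mulrC.
rewrite ler_wpM2r//; apply: ge0_ler_powR; rewrite ?nnegrE//.
  by rewrite subr_ge0 ltW.
exact: le_trans xh.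
Qed.

(** The contraction factor of the bisection in [sewing_inequality]. *)
Lemma powR_half_lt : 2 * (2^-1 : R) `^ theta < 1.
Proof.
rewrite -mulr_powRB1 ?(lt_trans ltr01)// mulrA divff// mul1r.
apply: (@lt_le_trans _ _ (1 `^ (theta - 1))); last by rewrite powR1.
apply: gt0_ltr_powR; rewrite ?nnegrE ?subr_gt0//; lra.
Qed.

Lemma powR_halves (x y D : R) : 0 <= x <= D / 2 -> 0 <= y <= D / 2 ->
  x `^ theta + y `^ theta <= 2 * (2^-1 : R) `^ theta * D `^ theta.
Proof.
have t0 : 0 <= theta by rewrite ltW// (lt_trans ltr01).
move=> /andP[x0 xD] /andP[y0 yD].
rewrite -mulrA -powRM; [|by rewrite invr_ge0|lra].
rewrite [2^-1 * D]mulrC mulr_natl mulr2n lerD//; apply: ge0_ler_powR => //;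
  rewrite nnegrE; lra.
Qed.

Lemma powR_small (C e : R) : 0 <= C -> 0 < e ->
  exists2 d : R, 0 < d & d `^ (theta - 1) * C < e.
Proof.
move=> C0 e0; have t0 : theta - 1 != 0 by rewrite subr_eq0 gt_eqF.
exists ((e / (C + 1)) `^ (theta - 1)^-1).
  by rewrite powR_gt0// divr_gt0// ltr_wpDl.
have C1 : 0 < C + 1 by rewrite ltr_wpDl.
rewrite -powRrM mulVf// powRr1 ?divr_ge0 ?ltW//.
by rewrite mulrAC ltr_pdivrMr// mulrDr mulr1 ltrDl.
Qed.

End Powers.

Section Sewing.
Variables (R : realType) (a b theta : R).
Hypothesis theta1 : 1 < theta.

(** The point of the definition is theta > 1: an error of this size is
    negligible when summed along a fine partition. *)
Definition has_germ (F : R -> R) (A : R -> R -> R) : Prop :=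
  exists K : R, forall u v, a <= u -> u <= v -> v <= b ->
    `|F v - F u - A u v| <= K * (v - u) `^ theta.

Definition almost_additive (A : R -> R -> R) (M : R) : Prop :=
  forall u v w, a <= u -> u <= v -> v <= w -> w <= b ->
    `|A u w - A u v - A v w| <= M * (w - u) `^ theta.

Lemma almost_additive_diag A M u : almost_additive A M ->
  a <= u -> u <= b -> A u u = 0.
Proof.
move=> AM au ub; apply/eqP; rewrite -normr_eq0 -normrN eq_le normr_ge0 andbT.
have := AM u u u au (lexx _) (lexx _) ub.
by rewrite !subrr powR0 ?mulr0 ?sub0r// gt_eqF// (lt_trans ltr01).
Qed.

Definition subdivision (x : nat -> R) (n : nat) (u v : R) : Prop :=
  [/\ x 0%N = u, x n = v & forall i, (i < n)%N -> x i <= x i.+1].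

Lemma subdivision_homo x n u v : subdivision x n u v ->
  forall i j, (i <= j)%N -> (j <= n)%N -> x i <= x j.
Proof.
move=> [_ _ xS] i j /subnK <-; elim: (j - i)%N => [|k IH] // kn.
by apply: le_trans (xS _ _) => //; apply: IH; apply: ltnW.
Qed.

Lemma subdivision_take x n u v k : (k <= n)%N -> subdivision x n u v ->
  subdivision x k u (x k).
Proof. by move=> kn [x0 xn xS]; split=> // i ik; apply/xS/(leq_trans ik). Qed.

Lemma subdivision_drop x n u v k : (k <= n)%N -> subdivision x n u v ->
  subdivision (fun i => x (k + i)%N) (n - k) (x k) v.
Proof.
move=> kn [x0 xn xS]; split; rewrite ?addn0 ?subnKC// => i ik.
by rewrite addnS; apply: xS; rewrite -ltn_subRL.
Qed.

(** The first step that leaves at most half of [u, v] uncovered; by minimality,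
    at most half is covered before that step. *)
Lemma subdivision_middle x n u v : subdivision x n.+1 u v ->
  exists2 k, (k <= n)%N & x k - u <= (v - u) / 2 /\ v - x k.+1 <= (v - u) / 2.
Proof.
move=> sx; have [x0 xn _] := sx.
have uv : u <= v by rewrite -x0 -xn (subdivision_homo sx).
pose P k := (k == n) || (v - x k.+1 <= (v - u) / 2).
have exP : exists k, P k by exists n; rewrite /P eqxx.
case: (ex_minnP exP) => k Pk kmin.
have kn : (k <= n)%N by apply: kmin; rewrite /P eqxx.
exists k => //; split.
  case: k Pk kmin kn => [_ _ _|k _ kmin kn]; first by rewrite x0; lra.
  have : ~~ P k by apply/negP => /kmin; rewrite ltnn.
  by rewrite /P negb_or -ltNge => /andP[_]; lra.
by case/orP: Pk => // /eqP ->; rewrite xn; lra.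
Qed.

(** The bound is uniform over all subdivisions, whatever their number of
    points.  Cutting at the step k of [subdivision_middle] leaves two
    subdivisions of intervals of at most half the length, whose errors add up to
    at most q K (v - u)^theta with q = 2 (1/2)^theta < 1, and costs two
    defects of additivity.  The induction closes as soon as
    q K + 2 |M| = K. *)
Lemma sewing_inequality A M : almost_additive A M -> a <= b ->
  exists2 K : R, 0 <= K & forall n x u v, a <= u -> v <= b ->
    subdivision x n u v ->
    `|\sum_(0 <= i < n) A (x i) (x i.+1) - A u v| <= K * (v - u) `^ theta.
Proof.
move=> AM ab; set q := 2 * (2^-1 : R) `^ theta.
have q1 : q < 1 by exact: powR_half_lt.
have q0 : 0 <= q by rewrite mulr_ge0 ?powR_ge0.
pose M' := `|M|; exists (2 * M' / (1 - q)) => [|n].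
  by rewrite divr_ge0 ?mulr_ge0 ?normr_ge0 ?subr_ge0 ?ltW.
set K := 2 * M' / (1 - q).
have KE : K * q + 2 * M' = K.
  rewrite /K; field; lra.
have K0 : 0 <= K by rewrite divr_ge0 ?mulr_ge0 ?normr_ge0 ?subr_ge0 ?ltW.
elim/ltn_ind: n => -[_|n IH] x u v au vb sx.
  case: sx au vb => <- <- _ xa xb.
  by rewrite big_geq// (almost_additive_diag AM)// subrr normr0 mulr_ge0 ?powR_ge0.
have [k kn [kl kr]] := subdivision_middle sx.
have [x0 xn xS] := sx.
have hm := subdivision_homo sx.
have uk : u <= x k by rewrite -x0 hm// ltnW.
have kk1 : x k <= x k.+1 by rewrite hm.
have k1v : x k.+1 <= v by rewrite -xn hm.
have xkb : x k <= b by rewrite (le_trans kk1)// (le_trans k1v).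
have axk : a <= x k.+1 by rewrite (le_trans au)// (le_trans uk).
have El := IH k _ _ _ _ au xkb (subdivision_take (leqW kn) sx).
have := subdivision_drop (n := n.+1) (k := k.+1) kn sx.
rewrite subSS => sr; have {IH sr} := IH _ _ _ _ _ axk vb sr.
rewrite ltnS leq_subr => /(_ isT) Er.
have {}El := El kn.
rewrite (big_cat_nat (n := k)) ?(leqW kn)//= (big_ltn (m := k))//.
(* reindex the sum past k as the sum along the subdivision of the right half *)
rewrite -{2}[k.+1]add0n big_addn subSS.
under [X in _ + (_ + X)]eq_bigr do rewrite addnC -addnS.
have D1 := AM u (x k) v au uk (le_trans kk1 k1v) vb.
have D2 := AM (x k) (x k.+1) v (le_trans au uk) kk1 k1v vb.
set Sl := \sum_(0 <= i < k) _ in El *.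
set Sr := \sum_(0 <= i < n - k) _ in Er *.
have vu : 0 <= v - u by rewrite subr_ge0 (le_trans uk)// (le_trans kk1).
have H := powR_halves theta1 (x := x k - u) (y := v - x k.+1) (D := v - u).
have {}H := H ltac:(lra) ltac:(lra).
have P : (v - x k) `^ theta <= (v - u) `^ theta.
  apply: ge0_ler_powR; rewrite ?nnegrE ?(ltW (lt_trans ltr01 theta1))//; lra.
have MM : M <= M' by exact: ler_norm.
have -> : Sl + (A (x k) (x k.+1) + Sr) - A u v =
    (Sl - A u (x k)) + (Sr - A (x k.+1) v)
     - (A u v - A u (x k) - A (x k) v)
     - (A (x k) v - A (x k) (x k.+1) - A (x k.+1) v) by ring.
rewrite -KE mulrDl -mulrA.
apply: (le_trans (ler_normB _ _)).
apply: (@le_trans _ _ (K * (q * (v - u) `^ theta) + M' * (v - u) `^ theta +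
   M' * (v - u) `^ theta)); last lra.
apply: lerD; last first.
  apply: (le_trans D2); apply: (le_trans (ler_wpM2r _ MM)); first exact: powR_ge0.
  by rewrite ler_wpM2l ?normr_ge0.
apply: (le_trans (ler_normB _ _)); apply: lerD; last first.
  by apply: (le_trans D1); rewrite ler_wpM2r// powR_ge0.
apply: (le_trans (ler_normD _ _)); apply: (le_trans (lerD El Er)).
by rewrite -mulrDr ler_wpM2l.
Qed.
End Sewing.

(** * Existence of a function with a given germ *)

Section UltrafilterLimits.
Local Open Scope classical_set_scope.

(** A generalized limit.  It lets [sewing] pass to the limit in all grid sums at
    once from their boundedness alone, without proving that they converge. *)
Lemma ultrafilter_limits (R : realType) : exists G : set_system nat,
  [/\ ProperFilter G, \oo `<=` G &
      forall (f : nat -> R) (B : R), (forall n, `|f n| <= B) ->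
        exists l : R, f @ G --> l].
Proof.
have [G [GU ooG]] := ultraFilterLemma eventually_filter.
exists G; split=> // [|f B fB]; first exact: (@ultra_proper _ _ GU).
have GfB : (f @ G) `[- B, B]%classic.
  rewrite /nbhs/=; apply: (@filterS _ G _ setT) filterT => n _ /=.
  by rewrite in_itv/= -ler_norml.
have [l [_ cl]] := segment_compact (fmap_proper_filter f (@ultra_proper _ _ GU)) GfB.
exists l => P Pl; have [//|nGP] := in_ultra_setVsetC (f @^-1` P) GU.
(* a set of the ultrafilter that avoids P would contradict clustering at l *)
by have [? []] := cl (~` P) P nGP Pl.
Qed.

End UltrafilterLimits.

Section Grids.
Local Open Scope classical_set_scope.
Variables (R : realType) (theta : R).
Hypothesis theta1 : 1 < theta.

(** Why exponents above 1 matter: errors of order theta on the cells of a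
    subdivision sum to something that vanishes with the mesh h. *)
Lemma norm_sum_mesh (E : nat -> R) (K h : R) x n u v :
  0 <= K -> subdivision x n u v -> (forall i, (i < n)%N -> x i.+1 - x i <= h) ->
  (forall i, (i < n)%N -> `|E i| <= K * (x i.+1 - x i) `^ theta) ->
  `|\sum_(0 <= i < n) E i| <= h `^ (theta - 1) * (K * (v - u)).
Proof.
move=> K0 [x0 xn xS] xh EK; rewrite -x0 -xn -telescope_sumr// !mulr_sumr.
apply: le_trans (ler_norm_sum _ _ _) _.
rewrite !big_nat; apply: ler_sum => i /andP[_ ilt].
apply: le_trans (EK _ ilt) _; rewrite mulrCA ler_wpM2l// powR_le_mesh//.
by rewrite subr_ge0 xS// xh.
Qed.

Definition grid (u v : R) (n i : nat) : R := u + i%:R * ((v - u) / n%:R).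

Lemma gridB u v n i : grid u v n i.+1 - grid u v n i = (v - u) / n%:R.
Proof. by rewrite /grid -natr1; ring. Qed.

Lemma grid_subdivision u v n : u <= v -> (0 < n)%N ->
  subdivision (grid u v n) n u v.
Proof.
move=> uv n0; split=> [||i _].
- by rewrite /grid mul0r addr0.
- by rewrite /grid mulrCA divff ?mulr1 ?pnatr_eq0 -?lt0n// addrC subrK.
- by rewrite -subr_ge0 gridB divr_ge0 ?subr_ge0.
Qed.

Lemma grid_fine (u v d : R) : 0 < d ->
  \forall n \near \oo, (0 < n)%N /\ (v - u) / n%:R <= d.
Proof.
move=> d0; exists (Num.trunc `|(v - u) / d|).+1 => // n /= nN.
have n0 : (0 < n)%N by apply: leq_trans nN.
split=> //; rewrite ler_pdivrMr ?ltr0n// mulrC -ler_pdivrMr//.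
apply: le_trans (ler_norm _) _; apply/ltW/(lt_le_trans (truncnS_gt _)).
by rewrite ler_nat.
Qed.

Lemma subdivision_min (x : nat -> R) n u v w : subdivision x n u v -> u <= w -> w <= v ->
  subdivision (fun i => Num.min (x i) w) n u w.
Proof.
move=> [x0 xn xS] uw wv; split=> [||i ilt]; rewrite ?x0 ?xn.
- exact: min_l.
- exact: min_r.
- by rewrite le_min !ge_min lexx orbT xS.
Qed.

Lemma subdivision_max (x : nat -> R) n u v w : subdivision x n u v -> u <= w -> w <= v ->
  subdivision (fun i => Num.max w (x i)) n w v.
Proof.
move=> [x0 xn xS] uw wv; split=> [||i ilt]; rewrite ?x0 ?xn.
- exact: max_l.
- exact: max_r.
- by rewrite ge_max !le_max lexx/= xS ?orbT.
Qed.

End Grids.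

Section Existence.
Local Open Scope classical_set_scope.
Variables (R : realType) (a b theta : R).
Hypothesis theta1 : 1 < theta.
Hypothesis ab : a <= b.
Variables (A : R -> R -> R) (M : R).
Hypothesis AM : almost_additive a b theta A M.

Let M0 : 0 <= `|M|. Proof. exact: normr_ge0. Qed.

(** The two subtracted values of A cut the cell [p, q] at u.  If u lies outside the
    cell, one of the pieces is the cell and the other a degenerate one, so
    there is no defect at all. *)
Lemma cut_defect p q u : a <= p -> p <= q -> q <= b -> a <= u -> u <= b ->
  `|A p q - A (Num.min p u) (Num.min q u) - A (Num.max u p) (Num.max u q)|
    <= `|M| * (q - p) `^ theta.
Proof.
move=> ap pq qb au ub.
have M1 : 0 <= `|M| * (q - p) `^ theta by rewrite mulr_ge0 ?powR_ge0.
have [up|pu] := leP u p.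
  have uq := le_trans up pq.
  by rewrite (min_r uq) (max_r uq)
    (almost_additive_diag theta1 AM)// subr0 subrr normr0.
have [uq|qu] := leP u q.
  by apply: le_trans (AM ap (ltW pu) uq qb) _; rewrite ler_wpM2r ?powR_ge0 ?ler_norm.
by rewrite subrr (almost_additive_diag theta1 AM)// subr0 normr0.
Qed.

(** Truncating the grid of [a, b] at v, instead of subdividing [a, v] afresh,
    keeps the sums for different v on the same cells; they then differ by the
    sum over [u, v] up to the one cell cut by u. *)
Definition grid_sum (n : nat) (v : R) : R :=
  \sum_(0 <= i < n) A (Num.min (grid a b n i) v) (Num.min (grid a b n i.+1) v).

(** Cell by cell, this is [cut_defect] at the point u. *)
Lemma grid_sum_increment n u v : (0 < n)%N -> a <= u -> u <= v -> v <= b ->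
  `|grid_sum n v - grid_sum n u -
    \sum_(0 <= i < n) A (Num.max u (Num.min (grid a b n i) v))
                        (Num.max u (Num.min (grid a b n i.+1) v))| <=
  ((b - a) / n%:R) `^ (theta - 1) * (`|M| * (b - a)).
Proof.
move=> n0 au uv vb; have gS := grid_subdivision ab n0.
have av := le_trans au uv; have ub := le_trans uv vb.
have sv := subdivision_min gS av vb.
have [s0 sn sS] := sv.
apply: (@le_trans _ _ (((b - a) / n%:R) `^ (theta - 1) * (`|M| * (v - a)))); last first.
  by rewrite ler_wpM2l ?powR_ge0// ler_wpM2l// lerB.
rewrite /grid_sum -!sumrB; apply: (norm_sum_mesh theta1 M0 sv) => i ilt.
  rewrite -(gridB a b n i).
  have : grid a b n i <= grid a b n i.+1 by have [_ _ ->] := gS.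
  move: (grid a b n i) (grid a b n i.+1) => p q pq.
  by rewrite /Num.min; case: ltP => ?; case: ltP => ?; lra.
have mu x : Num.min x u = Num.min (Num.min x v) u.
  by rewrite -minA (min_r uv).
rewrite (mu (grid a b n i)) (mu (grid a b n i.+1)).
apply: cut_defect => //.
- by have := subdivision_homo sv (leq0n i) (ltnW ilt); rewrite s0.
- exact: sS.
- by apply: le_trans vb; have := subdivision_homo sv ilt (leqnn n); rewrite sn.
Qed.

(** By [sewing_inequality] on the grid clamped to [u, v], the increment of
    [grid_sum n] over [u, v] is within K (v - u)^theta of A u v, up to an error
    that vanishes with the mesh; any generalized limit F of the grid sums then
    has germ A. *)
Lemma sewing : exists2 F : R -> R, F a = 0 & has_germ a b theta F A.
Proof.
have [K K0 HK] := sewing_inequality theta1 AM ab.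
have approx n u v : (0 < n)%N -> a <= u -> u <= v -> v <= b ->
    `|grid_sum n v - grid_sum n u - A u v| <= K * (v - u) `^ theta +
      ((b - a) / n%:R) `^ (theta - 1) * (`|M| * (b - a)).
  move=> n0 au uv vb; have gS := grid_subdivision ab n0.
  have sv := subdivision_max (subdivision_min gS (le_trans au uv) vb) au uv.
  have := grid_sum_increment n0 au uv vb; have := HK _ _ _ _ au vb sv.
  set S := \sum_(0 <= i < n) _; move=> H1 H2.
  rewrite (_ : _ - _ - _ = (S - A u v) + (grid_sum n v - grid_sum n u - S)); last by ring.
  exact: le_trans (ler_normD _ _) (lerD H1 H2).
have [G [GF ooG Glim]] := ultrafilter_limits R.
(* the grid sums are bounded, hence have a limit, for v in [a, b] *)
have /choice[F HF] : forall v, exists l : R,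
    a <= v -> v <= b -> grid_sum ^~ v @ G --> l.
  move=> v.
  have [/andP[av vb]|/negP nv] := boolP (a <= v <= b); last first.
    by exists 0 => av vb; case: nv; rewrite av vb.
  have [|l lP] := Glim (grid_sum ^~ v) (`|A a v| + K * (v - a) `^ theta).
    move=> [|n]; first by rewrite /grid_sum big_geq// normr0 addr_ge0// mulr_ge0 ?powR_ge0.
    have sv := subdivision_min (grid_subdivision ab (ltn0Sn n)) av vb.
    rewrite -[grid_sum _ _](subrK (A a v)) addrC.
    apply: le_trans (ler_normD _ _) _; rewrite lerD2l; exact: HK sv.
  by exists l.
exists (fun v => F v - F a); first exact: subrr.
exists K => u v au uv vb; rewrite (_ : _ - _ - (_ - _) = F v - F u); last by ring.
apply/ler_addgt0Pr => e e0; have e3 : 0 < e / 3 by rewrite divr_gt0.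
have MB : 0 <= `|M| * (b - a) by rewrite mulr_ge0 ?subr_ge0.
have [d d0 dM] := powR_small theta1 MB e3.
have Fu := HF u au (le_trans uv vb); have Fv := HF v (le_trans au uv) vb.
have Gu : \forall n \near G, `|F u - grid_sum n u| < e / 3 by exact: cvgr_dist_lt Fu _ e3.
have Gv : \forall n \near G, `|F v - grid_sum n v| < e / 3 by exact: cvgr_dist_lt Fv _ e3.
have Gd := ooG _ (grid_fine a b d0).
have [n [[hu hv] [n0 nd]]] := filter_ex (filterI (filterI Gu Gv) Gd).
have {}dM : ((b - a) / n%:R) `^ (theta - 1) * (`|M| * (b - a)) < e / 3.
  apply: le_lt_trans dM; rewrite ler_wpM2r//; apply: ge0_ler_powR => //.
  - by rewrite subr_ge0 ltW.
  - by rewrite nnegrE divr_ge0 ?subr_ge0.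
  - by rewrite nnegrE ltW.
have := approx n u v n0 au uv vb.
rewrite (_ : F v - F u - A u v = (F v - grid_sum n v) +
  ((grid_sum n v - grid_sum n u - A u v) - (F u - grid_sum n u))); last by ring.
move=> H; apply: le_trans (ler_normD _ _) _.
have := ler_normB (grid_sum n v - grid_sum n u - A u v) (F u - grid_sum n u).
lra.
Qed.

End Existence.

(** * Germ calculus and the Young integral *)

Section GermCalculus.
Variables (R : realType) (a b theta : R).

Local Notation germ := (has_germ a b theta).

Lemma germP F A : germ F A -> exists2 K : R, 0 <= K & forall u v,
  a <= u -> u <= v -> v <= b -> `|F v - F u - A u v| <= K * (v - u) `^ theta.
Proof.
move=> [K HK]; exists `|K| => // u v au uv vb.
by apply: le_trans (HK _ _ au uv vb) _; rewrite ler_wpM2r ?powR_ge0 ?ler_norm.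
Qed.

Lemma germ_ext F F' A A' :
  (forall u, a <= u <= b -> F u = F' u) ->
  (forall u v, a <= u <= b -> a <= v <= b -> A u v = A' u v) ->
  germ F A -> germ F' A'.
Proof.
move=> FF' AA' [K HK]; exists K => u v au uv vb.
have ub : a <= u <= b by rewrite au (le_trans uv).
have vab : a <= v <= b by rewrite vb (le_trans au).
by rewrite -!FF' -?AA' ?HK.
Qed.

Lemma germ0 : germ (fun=> 0) (fun _ _ => 0).
Proof. by exists 0 => u v _ _ _; rewrite !subr0 normr0 mul0r. Qed.

Lemma germD F A G B : germ F A -> germ G B ->
  germ (fun u => F u + G u) (fun u v => A u v + B u v).
Proof.
move=> [K HK] [L HL]; exists (K + L) => u v au uv vb.
rewrite (_ : _ - _ = (F v - F u - A u v) + (G v - G u - B u v)); last by ring.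
by rewrite mulrDl; apply: le_trans (ler_normD _ _) (lerD (HK _ _ _ _ _) (HL _ _ _ _ _)).
Qed.

Lemma germ_sum (I : eqType) (r : seq I) (P : pred I) F A :
  (forall i, i \in r -> P i -> germ (F i) (A i)) ->
  germ (fun u => \sum_(i <- r | P i) F i u) (fun u v => \sum_(i <- r | P i) A i u v).
Proof.
elim: r => [|i r IH] Hr.
  by apply: germ_ext germ0 => *; rewrite big_nil.
have {}IH : germ (fun u => \sum_(i <- r | P i) F i u)
                 (fun u v => \sum_(i <- r | P i) A i u v).
  by apply: IH => j jr; apply: Hr; rewrite inE jr orbT.
case Pi: (P i).
  have Hi : germ (F i) (A i) by apply: Hr; rewrite ?inE ?eqxx.
  by apply: germ_ext (germD Hi IH) => *; rewrite big_cons Pi.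
by apply: germ_ext IH => *; rewrite big_cons Pi.
Qed.

(** The difference of the two functions has increments O((v - u)^theta), so
    summing over finer and finer grids shows that it is constant. *)
Lemma germ_unique F G A : 1 < theta -> germ F A -> germ G A -> F a = G a ->
  forall v, a <= v <= b -> F v = G v.
Proof.
move=> theta1 /germP[K K0 HK] /germP[L L0 HL] Fa v /andP[av vb].
pose D u := F u - G u.
suff : D v - D a = 0 by rewrite /D Fa subrr subr0 => /eqP; rewrite subr_eq0 => /eqP.
apply/eqP; rewrite -normr_le0; apply/ler_addgt0Pr => e e0; rewrite add0r.
have KL0 : 0 <= K + L by rewrite addr_ge0.
have KLv : 0 <= (K + L) * (v - a) by rewrite mulr_ge0 ?subr_ge0.
have [d d0 de] := powR_small theta1 KLv e0.
have [n [n0 nd]] := filter_ex (grid_fine a v d0).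
have gS := grid_subdivision av n0; have [g0 gn _] := gS.
have /= := telescope_sumr (fun i => D (grid a v n i)) (leq0n n).
rewrite g0 gn => <-.
apply: le_trans (ltW de); apply: (norm_sum_mesh theta1 KL0 gS) => i ilt.
  by rewrite gridB.
have gm := subdivision_homo gS.
have agi : a <= grid a v n i by have := gm _ _ (leq0n i) (ltnW ilt); rewrite g0.
have gib : grid a v n i.+1 <= b.
  by apply: le_trans vb; have := gm _ _ ilt (leqnn n); rewrite gn.
have gg : grid a v n i <= grid a v n i.+1 by apply: gm.
move: agi gib gg; move: (grid a v n i) (grid a v n i.+1) => p q ap qb pq.
rewrite /D (_ : _ - _ = (F q - F p - A p q) - (G q - G p - A p q)); last by ring.
rewrite [leRHS]mulrDl; apply: le_trans (ler_normB _ _) _.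
by apply: lerD; [exact: HK|exact: HL].
Qed.

End GermCalculus.

Section Hoelder.
Variables (R : realType) (a b beta : R).

(** Confined to [a, b] because the integral from a to v carries no information
    for v < a, where no partition exists. *)
Definition hoelder_in (f : R -> R) : Prop :=
  exists2 C : R, 0 <= C & forall u v, a <= u -> u <= v -> v <= b ->
    `|f v - f u| <= C * (v - u) `^ beta.

Local Notation hoelder := hoelder_in.

Lemma hoelder_ext f f' : (forall u, a <= u <= b -> f u = f' u) ->
  hoelder f -> hoelder f'.
Proof.
move=> ff' [C C0 HC]; exists C => // u v au uv vb.
by rewrite -!ff' ?HC// ?au ?vb ?(le_trans uv) ?(le_trans au).
Qed.

Lemma hoelder_cst c : hoelder (fun=> c).
Proof. by exists 0 => // u v _ _ _; rewrite subrr normr0 mul0r. Qed.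

Lemma hoelderD f g : hoelder f -> hoelder g -> hoelder (fun u => f u + g u).
Proof.
move=> [C C0 HC] [D D0 HD]; exists (C + D); first exact: addr_ge0.
move=> u v au uv vb; rewrite (_ : _ - _ = (f v - f u) + (g v - g u)); last by ring.
by rewrite mulrDl; apply: le_trans (ler_normD _ _) (lerD (HC _ _ _ _ _) (HD _ _ _ _ _)).
Qed.

Lemma hoelder_sum (I : eqType) (r : seq I) (P : pred I) f :
  (forall i, i \in r -> P i -> hoelder (f i)) ->
  hoelder (fun u => \sum_(i <- r | P i) f i u).
Proof.
elim: r => [|i r IH] Hr.
  by apply: hoelder_ext (hoelder_cst 0) => *; rewrite big_nil.
have {}IH : hoelder (fun u => \sum_(i <- r | P i) f i u).
  by apply: IH => j jr; apply: Hr; rewrite inE jr orbT.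
case Pi: (P i).
  have Hi : hoelder (f i) by apply: Hr; rewrite ?inE ?eqxx.
  by apply: hoelder_ext (hoelderD Hi IH) => *; rewrite big_cons Pi.
by apply: hoelder_ext IH => *; rewrite big_cons Pi.
Qed.

Hypothesis beta0 : 0 < beta.

Lemma powR_beta_le (x y : R) : 0 <= x -> x <= y -> x `^ beta <= y `^ beta.
Proof.
move=> x0 xy; apply: ge0_ler_powR => //; first exact: ltW.
by rewrite nnegrE (le_trans x0).
Qed.

Lemma hoelder_bounded f : hoelder f ->
  exists2 B : R, 0 <= B & forall u, a <= u <= b -> `|f u| <= B.
Proof.
move=> [C C0 HC]; exists (`|f a| + C * (b - a) `^ beta).
  by rewrite addr_ge0 ?mulr_ge0 ?powR_ge0.
move=> u /andP[au ub]; rewrite -[f u](subrK (f a)) addrC.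
apply: le_trans (ler_normD _ _) _; rewrite lerD2l.
apply: le_trans (HC _ _ (lexx _) au ub) _.
by rewrite ler_wpM2l// powR_beta_le ?subr_ge0// lerB.
Qed.

End Hoelder.

Section Young.
Variables (R : realType) (a b beta : R).
Hypothesis beta_half : 2^-1 < beta.
Hypothesis ab : a <= b.

Local Notation hoelder := (hoelder_in a b beta).
Local Notation germ := (has_germ a b (beta + beta)).

Let beta0 : 0 < beta. Proof. by apply: lt_trans beta_half; rewrite invr_gt0. Qed.
Let theta1 : 1 < beta + beta. Proof. by move: beta_half; lra. Qed.

Definition young (f g : R -> R) (u v : R) : R := f u * (g v - g u).

Lemma powR_beta_sq (x : R) : x `^ beta * x `^ beta = x `^ (beta + beta).
Proof. by rewrite powRD// gt_eqF// addr_gt0. Qed.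

Lemma young_almost_additive f g : hoelder f -> hoelder g ->
  exists M, almost_additive a b (beta + beta) (young f g) M.
Proof.
move=> [C C0 HC] [D D0 HD]; exists (C * D) => u v w au uv vw wb.
rewrite /young (_ : _ - _ = - ((f v - f u) * (g w - g v))); last by ring.
rewrite normrN normrM -powR_beta_sq mulrACA; apply: ler_pM => //.
  apply: le_trans (HC _ _ au uv (le_trans vw wb)) _.
  by rewrite ler_wpM2l// powR_beta_le ?subr_ge0// lerB.
apply: le_trans (HD _ _ (le_trans au uv) vw wb) _.
by rewrite ler_wpM2l// powR_beta_le ?subr_ge0// lerB.
Qed.

(** Integration against g does not lose regularity, so iterated integrals can
    be integrated again. *)
Lemma germ_hoelder F f g : hoelder f -> hoelder g -> germ F (young f g) ->
  hoelder F.
Proof.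
move=> /(hoelder_bounded beta0)[B B0 HB] [D D0 HD] /germP[K K0 HK].
exists (B * D + K * (b - a) `^ beta).
  by rewrite addr_ge0 ?mulr_ge0 ?powR_ge0.
move=> u v au uv vb; rewrite -[_ - _](subrK (young f g u v)) addrC.
apply: le_trans (ler_normD _ _) _; rewrite mulrDl; apply: lerD.
  rewrite /young normrM -mulrA; apply: ler_pM => //; last exact: HD.
  by rewrite HB// au (le_trans uv).
apply: le_trans (HK _ _ au uv vb) _; rewrite -mulrA ler_wpM2l// -powR_beta_sq.
by rewrite ler_wpM2r ?powR_ge0// powR_beta_le ?subr_ge0// lerB.
Qed.

(** The product rule: the remainder of the Leibniz expansion is the product of
    the increments of F and G, which is of order beta + beta. *)
Lemma germM F A G B : hoelder F -> hoelder G -> germ F A -> germ G B ->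
  germ (fun u => F u * G u) (fun u v => G u * A u v + F u * B u v).
Proof.
move=> hF hG /germP[K K0 HK] /germP[L L0 HL].
have [BF BF0 HBF] := hoelder_bounded beta0 hF.
have [BG BG0 HBG] := hoelder_bounded beta0 hG.
have [C C0 HC] := hF; have [D D0 HD] := hG.
exists (BG * K + BF * L + C * D) => u v au uv vb.
have ub : a <= u <= b by rewrite au (le_trans uv).
rewrite (_ : _ - _ = G u * (F v - F u - A u v) + F u * (G v - G u - B u v)
  + (F v - F u) * (G v - G u)); last by ring.
rewrite [leRHS]mulrDl; apply: le_trans (ler_normD _ _) _; apply: lerD.
  rewrite [leRHS]mulrDl; apply: le_trans (ler_normD _ _) _.
  by apply: lerD; rewrite normrM -mulrA ler_pM ?HBF ?HBG ?HK ?HL.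
by rewrite normrM -powR_beta_sq mulrACA ler_pM ?HC ?HD.
Qed.

Lemma itv_partition_subdivision (v : R) s : itv_partition a v s ->
  subdivision (part_pt a s) (size s) a v.
Proof.
move=> [/(pathP a) sP /eqP sv]; split=> //; first by rewrite /part_pt -last_nth.
by move=> i ilt; apply/ltW/sP.
Qed.

(** On each cell, replacing the left end by the tag costs a product of two
    increments of order beta, and replacing the germ by the increment of F costs
    the germ error: both are of order beta + beta > 1. *)
Lemma is_RSint_young F f g v : hoelder f -> hoelder g -> germ F (young f g) ->
  a <= v <= b -> is_RSint f g a v (F v - F a).
Proof.
move=> [C C0 HC] [D D0 HD] /germP[K K0 HK] /andP[av vb] e e0.
have K'0 : 0 <= C * D + K by rewrite addr_ge0 ?mulr_ge0.
have H0 : 0 <= (C * D + K) * (v - a) by rewrite mulr_ge0 ?subr_ge0.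
have [d d0 de] := powR_small theta1 H0 e0.
exists d => // s t /itv_partition_subdivision sS sd ts.
have [x0 xn xS] := sS.
have /= := telescope_sumr (fun i => F (part_pt a s i)) (leq0n (size s)).
rewrite x0 xn => <-.
rewrite /RS_sum -sumrB; apply: le_lt_trans de.
apply: (norm_sum_mesh theta1 K'0 sS) => i ilt; first exact/ltW/sd.
have gm := subdivision_homo sS.
have api : a <= part_pt a s i by have := gm _ _ (leq0n i) (ltnW ilt); rewrite x0.
have pib : part_pt a s i.+1 <= b.
  by apply: le_trans vb; have := gm _ _ ilt (leqnn _); rewrite xn.
have /andP[pt tq] := ts i ilt.
move: api pib pt tq; move: (part_pt a s i) (part_pt a s i.+1) => p q ap qb pt tq.
have pq := le_trans pt tq.
rewrite (_ : _ - _ = (f (t i) - f p) * (g q - g p) - (F q - F p - young f g p q));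
  last by rewrite /young; ring.
rewrite [leRHS]mulrDl; apply: le_trans (ler_normB _ _) _; apply: lerD; last exact: HK.
rewrite normrM -powR_beta_sq mulrACA; apply: ler_pM => //; last exact: HD.
apply: le_trans (HC _ _ ap pt (le_trans tq qb)) _.
by rewrite ler_wpM2l// powR_beta_le ?subr_ge0// lerB.
Qed.

End Young.

Section RiemannStieltjes.
Variable R : realType.

Lemma fine_tagged_partition (a v d : R) : a <= v -> 0 < d ->
  exists s : seq R, exists t : nat -> R,
    [/\ itv_partition a v s, mesh_lt a s d & is_tagging a s t].
Proof.
move=> av d0; (* the degenerate interval is partitioned by the empty sequence only *)
have [|] := leP v a => [va|{}av].
  by exists [::], (fun=> a); split=> //; split=> //=; rewrite eq_le av va.
have d2 : 0 < d / 2 by rewrite divr_gt0.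
have [n [n0 nd]] := filter_ex (grid_fine a v d2).
pose s := mkseq (fun i => grid a v n i.+1) n.
have gS := grid_subdivision (ltW av) n0; have [g0 gn gm] := gS.
have ss : size s = n by rewrite size_mkseq.
have ptE i : (i <= n)%N -> part_pt a s i = grid a v n i.
  case: i => [|i] ilt; rewrite /part_pt ?g0//= nth_mkseq//.
exists s, (part_pt a s); split.
- split; last by rewrite (last_nth a) ss -/(part_pt a s n) ptE// gn.
  apply/(pathP a) => i; rewrite ss => ilt.
  rewrite -[nth a s i]/(part_pt a s i.+1) -/(part_pt a s i) !ptE//; last exact: ltnW.
  by rewrite -subr_gt0 gridB divr_gt0 ?subr_gt0 ?ltr0n.
- move=> i; rewrite ss => ilt; rewrite !ptE//; last exact: ltnW.
  by rewrite gridB; lra.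
- by move=> i; rewrite ss => ilt; rewrite !ptE ?lexx/= ?gm// ltnW.
Qed.

Lemma is_RSint_unique (f g : R -> R) (a v I J : R) : a <= v ->
  is_RSint f g a v I -> is_RSint f g a v J -> I = J.
Proof.
move=> av HI HJ; apply/eqP; rewrite -subr_eq0 -normr_le0.
apply/ler_addgt0Pr => e e0; rewrite add0r.
have e2 : 0 < e / 2 by rewrite divr_gt0.
have [d d0 Id] := HI _ e2; have [d' d'0 Jd] := HJ _ e2.
have dd : 0 < Num.min d d' by rewrite lt_min d0.
have [s [t [sp sm st]]] := fine_tagged_partition av dd.
have sd : mesh_lt a s d.
  by move=> i /sm/lt_le_trans; apply; rewrite ge_min lexx.
have sd' : mesh_lt a s d'.
  by move=> i /sm/lt_le_trans; apply; rewrite ge_min lexx orbT.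
have H1 := Id _ _ sp sd st; have H2 := Jd _ _ sp sd' st.
rewrite (_ : I - J = (RS_sum f g a s t - J) - (RS_sum f g a s t - I)); last by ring.
by apply: le_trans (ler_normB _ _) _; lra.
Qed.

Lemma RSint_eq (f g : R -> R) (a v I : R) : a <= v ->
  is_RSint f g a v I -> RSint f g a v = I.
Proof.
move=> av HI; rewrite /RSint; case: xgetP => [J _ /= HJ|/(_ I)//].
exact: is_RSint_unique HJ HI.
Qed.

(** The only access to [RSint] used below: for Hoelder data of order above 1/2
    the integral is the function that [sewing] attaches to the Young germ. *)
Lemma RSint_young (a b beta : R) (f g : R -> R) : 2^-1 < beta -> a <= b ->
  hoelder_in a b beta f -> hoelder_in a b beta g ->
  RSint f g a a = 0 /\ has_germ a b (beta + beta) (RSint f g a) (young f g).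
Proof.
move=> hb ab hf hg; have theta1 : 1 < beta + beta by lra.
have [M AM] := young_almost_additive hb hf hg.
have [F Fa HF] := sewing theta1 ab AM.
have RE v : a <= v <= b -> F v = RSint f g a v.
  move=> vab; rewrite (@RSint_eq _ _ _ _ (F v - F a)) ?Fa ?subr0//.
    by case/andP: vab.
  by rewrite -[F v]subr0 -Fa; apply: (is_RSint_young hb hf hg).
split; first by rewrite -RE ?lexx// Fa.
exact: germ_ext RE _ HF.
Qed.

End RiemannStieltjes.

(** * Linear extensions and their iterated integrals *)

Section LinearExtensions.
Variables (T : eqType) (e : rel T).

(** The order constraint is stated negatively, no later letter is below an
    earlier one, so that appending a last letter adds exactly the condition
    that it be maximal. *)
Definition linexts (s : seq T) : seq (seq T) :=
  [seq w <- permutations s | pairwise (fun x y => ~~ e y x) w].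

Definition maximal (s : seq T) (x : T) : bool := all (fun y => ~~ e x y) s.

Lemma mem_linexts s w :
  (w \in linexts s) = pairwise (fun x y => ~~ e y x) w && perm_eq w s.
Proof. by rewrite mem_filter mem_permutations. Qed.

Lemma linexts_uniq s : uniq (linexts s).
Proof. by rewrite filter_uniq ?permutations_uniq. Qed.

Hypothesis e_irr : irreflexive e.

(** The last letter of a linear extension of s is maximal in s, and what
    precedes it is a linear extension of the remaining letters. *)
Lemma linexts_last s : uniq s -> s != [::] ->
  perm_eq (linexts s)
    [seq rcons w x | x <- [seq x <- s | maximal s x], w <- linexts (rem x s)].
Proof.
move=> us s0; apply: uniq_perm; first exact: linexts_uniq.
  apply: allpairs_uniq_dep => [|x _|]; first exact: filter_uniq.
    exact: linexts_uniq.
  by move=> [x w] [y v] _ _ /= /rcons_inj[-> ->].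
move=> v; rewrite mem_linexts; apply/andP/allpairsPdep => [[pv vs]|].
  case/lastP: v pv vs => [|w x].
    by move=> _; rewrite perm_sym => /perm_nilP s_nil; rewrite s_nil in s0.
  rewrite pairwise_rcons => /andP[/allP wx pw] ws.
  have xs : x \in s by rewrite -(perm_mem ws) mem_rcons mem_head.
  have pws : perm_eq w (rem x s).
    by rewrite -(perm_cons x) -(permPr (perm_to_rem xs)) -perm_rcons.
  exists x, w; split=> //; last by rewrite mem_linexts pw.
  rewrite mem_filter xs andbT; apply/allP => y ys.
  have [->|yx] := eqVneq y x; first by rewrite e_irr.
  by apply: wx; rewrite (perm_mem pws) mem_rem_uniq// inE yx.
move=> [x [w [+ + ->]]]; rewrite mem_filter mem_linexts => /andP[/allP mx xs].
move=> /andP[pw ws]; split.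
  rewrite pairwise_rcons pw andbT; apply/allP => y; rewrite (perm_mem ws) => yr.
  exact/mx/(mem_rem yr).
by rewrite perm_rcons (permPr (perm_to_rem xs)) perm_cons.
Qed.

End LinearExtensions.

Section IteratedIntegrals.
Variables (R : realType) (m : nat) (a b beta : R) (g : R -> 'rV[R]_m).
Hypothesis beta_half : 2^-1 < beta.
Hypothesis ab : a <= b.
Hypothesis hg : forall i, hoelder_in a b beta (fun u => g u 0 i).

Local Notation hoelder := (hoelder_in a b beta).
Local Notation germ := (has_germ a b (beta + beta)).
Local Notation coord i := (fun u => g u 0 i).

Let theta1 : 1 < beta + beta. Proof. by move: beta_half; lra. Qed.

Lemma iter_int_rcons w i u :
  iter_int g a (rcons w i) u = RSint (iter_int g a w) (coord i) a u.
Proof. by rewrite /iter_int foldl_rcons. Qed.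

Lemma iter_int_hoelder w : hoelder (iter_int g a w).
Proof.
elim/last_ind: w => [|w i IH]; first exact: hoelder_cst.
have [_ HF] := RSint_young beta_half ab IH (hg i).
apply: hoelder_ext (germ_hoelder beta_half IH (hg i) HF) => u _.
by rewrite iter_int_rcons.
Qed.

Lemma iter_int_germ w i :
  germ (iter_int g a (rcons w i)) (young (iter_int g a w) (coord i)).
Proof.
have [_ HF] := RSint_young beta_half ab (iter_int_hoelder w) (hg i).
by apply: germ_ext HF => // u _; rewrite iter_int_rcons.
Qed.

Lemma iter_int_start w i : iter_int g a (rcons w i) a = 0.
Proof.
by rewrite iter_int_rcons; have [] := RSint_young beta_half ab (iter_int_hoelder w) (hg i).
Qed.

Variables (T : eqType) (e : rel T) (lab : T -> 'I_m).
Hypothesis e_irr : irreflexive e.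

(** For a chain this is a single iterated integral; for two incomparable chains
    it is their shuffle product. *)
Definition order_sum (s : seq T) (u : R) : R :=
  \sum_(w <- linexts e s) iter_int g a (map lab w) u.

Lemma order_sum_nil u : order_sum [::] u = 1.
Proof. by rewrite /order_sum /linexts/= big_seq1. Qed.

Lemma order_sum_hoelder s : hoelder (order_sum s).
Proof. by apply: hoelder_sum => w _ _; exact: iter_int_hoelder. Qed.

Lemma order_sum_last s u : uniq s -> s != [::] ->
  order_sum s u = \sum_(x <- s | maximal e s x) \sum_(w <- linexts e (rem x s))
    iter_int g a (rcons (map lab w) (lab x)) u.
Proof.
move=> us s0; rewrite /order_sum (perm_big _ (linexts_last e_irr us s0))/=.
rewrite big_allpairs_dep big_filter; apply: eq_bigr => x _.
by apply: eq_bigr => w _; rewrite map_rcons.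
Qed.

Lemma order_sum_start s : uniq s -> s != [::] -> order_sum s a = 0.
Proof.
move=> us s0; rewrite order_sum_last// big1// => x _; rewrite big1// => w _.
exact: iter_int_start.
Qed.

(** In differential form: d Phi(s) is the sum of Phi(s - x) dg^(lab x) over the
    maximal letters x of s. *)
Lemma order_sum_germ s : uniq s -> s != [::] ->
  germ (order_sum s) (fun u v =>
    \sum_(x <- s | maximal e s x) young (order_sum (rem x s)) (coord (lab x)) u v).
Proof.
move=> us s0.
have H : germ (fun u => \sum_(x <- s | maximal e s x)
    \sum_(w <- linexts e (rem x s)) iter_int g a (rcons (map lab w) (lab x)) u)
  (fun u v => \sum_(x <- s | maximal e s x) \sum_(w <- linexts e (rem x s))
    young (iter_int g a (map lab w)) (coord (lab x)) u v).
  by do 2!apply: germ_sum => ? _ _; exact: iter_int_germ.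
apply: germ_ext H => [u _|u v _ _]; first by rewrite -order_sum_last.
by apply: eq_bigr => x _; rewrite /young -mulr_suml.
Qed.

(** Both sides vanish at a and, by induction on the number of letters, have the
    same germ: a maximal letter of the union is a maximal letter of one part,
    and its removal leaves the other part intact, as the product rule
    requires. *)
Lemma order_sum_cat s1 s2 : uniq (s1 ++ s2) ->
  (forall x y, x \in s1 -> y \in s2 -> ~~ e x y && ~~ e y x) ->
  forall u, a <= u <= b -> order_sum (s1 ++ s2) u = order_sum s1 u * order_sum s2 u.
Proof.
have [n] := ubnP (size (s1 ++ s2)); elim: n s1 s2 => // n IH s1 s2.
rewrite ltnS => sn u12 free.
have [->|s1_0] := eqVneq s1 [::] => [u _|]; first by rewrite order_sum_nil mul1r.
have [->|s2_0] := eqVneq s2 [::] => [u _|]; first by rewrite cats0 order_sum_nil mulr1.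
have /and3P[u1 /hasPn disj u2] : [&& uniq s1, ~~ has (mem s1) s2 & uniq s2].
  by rewrite -cat_uniq.
have s12_0 : s1 ++ s2 != [::] by rewrite -size_eq0 size_cat addn_eq0 size_eq0 (negPf s1_0).
have max1 x : x \in s1 -> maximal e (s1 ++ s2) x = maximal e s1 x.
  move=> xs1; rewrite /maximal all_cat [X in _ && X](_ : _ = true) ?andbT//.
  by apply/allP => y ys2; have /andP[] := free _ _ xs1 ys2.
have max2 x : x \in s2 -> maximal e (s1 ++ s2) x = maximal e s2 x.
  move=> xs2; rewrite /maximal all_cat [X in X && _](_ : _ = true)//.
  by apply/allP => y ys1; have /andP[] := free _ _ ys1 xs2.
have rem1 x : x \in s1 -> rem x (s1 ++ s2) = rem x s1 ++ s2.
  move=> xs1; rewrite !rem_filter// filter_cat; congr (_ ++ _).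
  by apply/all_filterP/allP => y /disj ys1; apply: contraNneq ys1 => ->.
have rem2 x : x \in s2 -> rem x (s1 ++ s2) = s1 ++ rem x s2.
  move=> /disj xs1; rewrite !rem_filter// filter_cat; congr (_ ++ _).
  by apply/all_filterP/allP => y ys1 /=; apply: contraNneq xs1 => <-.
have small x : x \in s1 ++ s2 -> (size (rem x (s1 ++ s2)) < n)%N.
  by move=> xs; rewrite size_rem// prednK// lt0n size_eq0.
apply: (germ_unique theta1 (order_sum_germ u12 s12_0)); last first.
  by rewrite !order_sum_start// mul0r.
apply: germ_ext (germM beta_half (order_sum_hoelder s1) (order_sum_hoelder s2)
  (order_sum_germ u1 s1_0) (order_sum_germ u2 s2_0)) => // u v uab _.
rewrite big_cat/= !mulr_sumr; congr (_ + _); rewrite [LHS]big_seq_cond [RHS]big_seq_cond.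
  apply: eq_big => [x|x /= /andP[xs1 _]]; first by apply: andb_id2l => /max1 ->.
  have xs : x \in s1 ++ s2 by rewrite mem_cat xs1.
  rewrite /young rem1// IH ?mulrA// -?rem1 ?small ?rem_uniq//.
    by rewrite [_ * order_sum s2 u]mulrC.
  by move=> y z /mem_rem ys zs; apply: free.
apply: eq_big => [x|x /= /andP[xs2 _]]; first by apply: andb_id2l => /max2 ->.
have xs : x \in s1 ++ s2 by rewrite mem_cat xs2 orbT.
rewrite /young rem2// IH ?mulrA// -?rem2 ?small ?rem_uniq//.
by move=> y z ys /mem_rem zs; apply: free.
Qed.

Lemma order_sum_top s c : uniq (rcons s c) -> maximal e (rcons s c) c ->
  (forall x, x \in s -> ~~ maximal e (rcons s c) x) ->
  germ (order_sum (rcons s c)) (young (order_sum s) (coord (lab c))).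
Proof.
move=> us mc ms; have sc0 : rcons s c != [::] by rewrite -size_eq0 size_rcons.
apply: germ_ext (order_sum_germ us sc0) => // u v _ _.
rewrite -cats1 big_cat/= big1_seq ?add0r => [|x /andP[mx xs]]; last first.
  by have := ms x xs; rewrite -cats1 mx.
rewrite big_cons cats1 mc big_nil addr0 rem_filter// filter_rcons/= eqxx/=.
rewrite (_ : seq.filter _ s = s)//; apply/all_filterP/allP => y ys /=.
by move: us; rewrite rcons_uniq => /andP[cs _]; apply: contraNneq cs => <-.
Qed.

Lemma order_sum_chain s : uniq s -> pairwise e s ->
  (forall x y, e x y -> ~~ e y x) ->
  forall u, a <= u <= b -> order_sum s u = iter_int g a (map lab s) u.
Proof.
move=> + + e_asym; elim/last_ind: s => [|s c IH]; first by move=> *; rewrite order_sum_nil.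
move=> us; rewrite pairwise_rcons => /andP[/allP sc ps].
have /andP[cs us'] : (c \notin s) && uniq s by rewrite -rcons_uniq.
apply: (germ_unique theta1 (order_sum_top us _ _)).
- apply/allP => y; rewrite mem_rcons inE => /predU1P[->|/sc/e_asym//].
  by rewrite e_irr.
- by move=> x xs; apply/allPn; exists c; rewrite ?mem_rcons ?mem_head// negbK sc.
- rewrite map_rcons; apply: germ_ext (iter_int_germ _ _) => // u v uab _.
  by rewrite /young IH.
- by rewrite map_rcons iter_int_start order_sum_start// -size_eq0 size_rcons.
Qed.

End IteratedIntegrals.

(** * The order behind Xi *)

Section Positions.
Local Open Scope nat_scope.
Variables (p : nat) (tau : nat -> nat).

(** The constraints that define Xi, read as a relation on positions counted
    from 0: block ends come in the order of the blocks, and each block is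
    increasing. *)
Definition before : rel nat := fun k l =>
  `[< (exists i j, [/\ 1 <= i, i < j <= p, k.+1 = tau i & l.+1 = tau j]) \/
      (exists i, [/\ 1 <= i <= p, tau i.-1 < k.+1, k < l & l.+1 <= tau i]) >].

Lemma Xi_before r (rho : {perm 'I_r}) :
  rho \in Xi r p tau <-> forall k l : 'I_r, before k l -> rho k < rho l.
Proof.
rewrite inE; split=> [/asboolP[H1 H2] k l /asboolP[[i [j []]]|[i []]]|H].
- by move=> *; apply: (H1 i j).
- by move=> *; apply: (H2 i).
apply/asboolP; split=> [i j k l i1 ij ki lj|i k l ip ik kl li]; apply/H/asboolP.
  by left; exists i, j.
by right; exists i.
Qed.

Hypothesis tau0 : tau 0 = 0.
Hypothesis tau_lt_succ : forall i, i < p -> tau i < tau i.+1.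

Lemma tau_mono i j : i < j -> j <= p -> tau i < tau j.
Proof.
elim: j => // j IH; rewrite ltnS leq_eqVlt => /predU1P[->|ij] jp; first exact: tau_lt_succ.
by apply: ltn_trans (tau_lt_succ jp); apply/IH/ltnW.
Qed.

Lemma tau_le i j : i <= j -> j <= p -> tau i <= tau j.
Proof. by rewrite leq_eqVlt => /predU1P[->//|ij] jp; apply/ltnW/tau_mono. Qed.

Lemma block_of q k : q <= p -> k < tau q -> exists2 i, i < q & tau i <= k < tau i.+1.
Proof.
elim: q => [_|q IH qp ktau]; first by rewrite tau0.
have [kq|qk] := ltnP k (tau q); last by exists q; rewrite ?qk.
by have [i iq Hi] := IH (ltnW qp) kq; exists i => //; apply: ltnW.
Qed.

Lemma before_lt k l : before k l -> k < l.
Proof.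
move=> /asboolP[[i [j [_ /andP[ij jp] ki lj]]]|[i []//]].
by rewrite -ltnS ki lj tau_mono.
Qed.

Lemma before_irr : irreflexive before.
Proof. by move=> k; apply/negP => /before_lt; rewrite ltnn. Qed.

Lemma before_asym k l : before k l -> ~~ before l k.
Proof. by move=> /before_lt kl; apply/negP => /before_lt; rewrite ltnNge ltnW. Qed.

(** The last position n of block q + 1 is the only maximal one up to there: an
    earlier position is followed within its own block or, when it ends its
    block, precedes the block end n. *)
Lemma before_top q n x : q < p -> n.+1 = tau q.+1 -> x < n ->
  exists2 y, y <= n & before x y.
Proof.
move=> qp nE xn; have [|i iq /andP[ix xi]] := @block_of q.+1 x qp.
  by rewrite -nE ltnS ltnW.
have ip : i < p by apply: leq_trans iq _.
have [xi'|xi'] := eqVneq x.+1 (tau i.+1).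
  have iq' : i.+1 < q.+1.
    rewrite ltn_neqAle iq andbT; apply: contraTneq xn => iqE.
    by rewrite -leqNgt -ltnS nE xi' iqE.
  exists n => //; apply/asboolP; left; exists i.+1, q.+1; split=> //.
  by rewrite iq'.
exists x.+1 => //; apply/asboolP; right; exists i.+1; split=> //.
by rewrite ltn_neqAle xi' xi.
Qed.

Lemma before_block q k l : q < p -> tau q <= k -> k < l -> l < tau q.+1 -> before k l.
Proof. by move=> qp qk kl lq; apply/asboolP; right; exists q.+1; split. Qed.

(** Block ends are the only link between blocks, so the positions of block
    q + 1 other than its end are incomparable with the earlier blocks. *)
Lemma before_free q k l : q < p -> k < tau q -> tau q <= l -> l.+1 < tau q.+1 ->
  ~~ before k l && ~~ before l k.
Proof.
move=> qp kq ql lq; apply/andP; split; apply/negP; last first.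
  by move=> /before_lt; rewrite ltnNge (leq_trans (ltnW kq)).
move=> /asboolP[[i [j [_ /andP[_ jp] _ lj]]]|[[|i] [/andP[i1 ip] ik _ li]]] //.
  have jq : j <= q.
    by rewrite leqNgt; apply: contraTN lq => qj; rewrite lj -leqNgt tau_le.
  by move: (tau_le jq (ltnW qp)); rewrite -lj ltnNge ql.
have iq : i < q.
  rewrite ltnNge; apply: contraTN kq => /tau_le/(_ (ltnW ip)) qi.
  by rewrite -leqNgt (leq_trans qi).
by move: (tau_le iq (ltnW qp)) => /(leq_trans li); rewrite ltnNge ql.
Qed.

End Positions.

Section Words.
Local Open Scope nat_scope.
Variables (r : nat) (e : rel nat).
Hypothesis e_irr : irreflexive e.

(** rho sends a position of the concatenated word to its rank, so the positions
    listed by increasing rank are the values of the inverse of rho. *)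
Definition perm_word (rho : {perm 'I_r}) : seq nat :=
  [seq val (rho^-1%g k) | k <- enum 'I_r].

Lemma nth_perm_word rho (k : 'I_r) : nth 0 (perm_word rho) k = rho^-1%g k.
Proof. by rewrite (nth_map k) ?size_enum_ord// nth_ord_enum. Qed.

Lemma perm_word_inj : injective perm_word.
Proof.
move=> rho pi eq_w; apply: invg_inj; apply/permP => k; apply: val_inj => /=.
by rewrite -!nth_perm_word eq_w.
Qed.

Lemma perm_word_perm rho : perm_eq (perm_word rho) (iota 0 r).
Proof.
rewrite -val_enum_ord /perm_word map_comp; apply: perm_map.
apply: uniq_perm; first by rewrite (map_inj_uniq perm_inj) enum_uniq.
  exact: enum_uniq.
move=> k; rewrite mem_enum; apply/mapP; exists (rho k); first by rewrite mem_enum.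
by rewrite permK.
Qed.

Lemma perm_word_surj w : perm_eq w (iota 0 r) -> exists rho, w = perm_word rho.
Proof.
move=> pw; have sw : size w = r by rewrite (perm_size pw) size_iota.
have uw : uniq w by rewrite (perm_uniq pw) iota_uniq.
have wlt (k : 'I_r) : nth 0 w k < r.
  have : nth 0 w k \in iota 0 r by rewrite -(perm_mem pw) mem_nth ?sw.
  by rewrite mem_iota.
pose f k := Ordinal (wlt k).
have finj : injective f.
  move=> k l /(congr1 val)/= /eqP; rewrite nth_uniq ?sw// => /eqP.
  exact: val_inj.
exists (perm finj)^-1%g; apply: (@eq_from_nth _ 0).
  by rewrite (perm_size (perm_word_perm _)) size_iota.
by rewrite sw => i ilt; rewrite (nth_perm_word _ (Ordinal ilt)) invgK permE.
Qed.

Lemma perm_word_pairwise rho :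
  pairwise (fun x y => ~~ e y x) (perm_word rho) <->
  forall k l : 'I_r, e k l -> rho k < rho l.
Proof.
have sw : size (perm_word rho) = r by rewrite size_map size_enum_ord.
split=> [/(pairwiseP 0) H k l ekl|H].
  rewrite ltnNge leq_eqVlt negb_or; apply/andP; split.
    apply: contraTneq ekl => /val_inj/perm_inj ->; by rewrite e_irr.
  apply: contraTN ekl => /(H (rho l) (rho k)); rewrite !inE sw !ltn_ord.
  by rewrite !nth_perm_word !permK; apply.
apply/(pairwiseP 0) => i j; rewrite !inE sw => ir jr ij.
rewrite (nth_perm_word _ (Ordinal ir)) (nth_perm_word _ (Ordinal jr)).
by apply/negP => /H; rewrite !permKV/= ltnNge ltnW.
Qed.

Lemma linexts_perm_word (X : {set {perm 'I_r}}) :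
  (forall rho, rho \in X <-> forall k l : 'I_r, e k l -> rho k < rho l) ->
  perm_eq (linexts e (iota 0 r)) [seq perm_word rho | rho <- enum X].
Proof.
move=> XP; apply: uniq_perm; first exact: linexts_uniq.
  by rewrite map_inj_uniq ?enum_uniq//; exact: perm_word_inj.
move=> w; rewrite mem_linexts; apply/andP/mapP => [[pw /perm_word_surj[rho wE]]|].
  by exists rho => //; rewrite mem_enum; apply/XP/perm_word_pairwise; rewrite -wE.
move=> [rho + ->]; rewrite mem_enum perm_word_perm => /XP/perm_word_pairwise.
by [].
Qed.

End Words.

Section Blocks.
Variables (m : nat) (i0 : 'I_m) (gammas : seq (seq 'I_m)).

Lemma block_end_succ q : (q < size gammas)%N ->
  block_end gammas q.+1 = (block_end gammas q + size (nth [::] gammas q))%N.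
Proof.
move=> qs; rewrite /block_end (take_nth 0%N) ?size_map// -cats1 sumn_cat /= addn0.
by rewrite (nth_map [::]).
Qed.

Lemma block_end_incr : (forall q, (q < size gammas)%N ->
    (0 < size (nth [::] gammas q))%N) ->
  forall q, (q < size gammas)%N -> (block_end gammas q < block_end gammas q.+1)%N.
Proof.
move=> ne q qp; rewrite block_end_succ// -[ltnLHS]addn0 ltn_add2l.
exact: ne.
Qed.

Lemma block_end_size : block_end gammas (size gammas) = total_length gammas.
Proof. by rewrite /block_end take_oversize ?size_map. Qed.

Lemma block_labels q : (q < size gammas)%N ->
  [seq nth i0 (flatten gammas) k
    | k <- iota (block_end gammas q) (size (nth [::] gammas q))] =
  nth [::] gammas q.
Proof.
move=> qs.
have fE : flatten gammas = flatten (take q gammas) ++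
    nth [::] gammas q ++ flatten (drop q.+1 gammas).
  by rewrite -[in LHS](cat_take_drop q gammas) (drop_nth [::] qs) flatten_cat.
have sE : block_end gammas q = size (flatten (take q gammas)).
  by rewrite size_flatten /shape map_take.
rewrite map_nth_iota fE sE ?drop_size_cat ?take_size_cat//.
by rewrite !size_cat addKn leq_addr.
Qed.

End Blocks.

Section Main.
Variables (R : realType) (m : nat) (a b beta : R) (g : R -> 'rV[R]_m).
Hypothesis beta_half : 2^-1 < beta.
Hypothesis ab : a <= b.
Hypothesis hg : forall i, hoelder_in a b beta (fun u => g u 0 i).
Variables (i0 : 'I_m) (gammas : seq (seq 'I_m)).
Hypothesis gammas_nonempty : forall q, (q < size gammas)%N ->
  (0 < size (nth [::] gammas q))%N.

Local Notation tau := (block_end gammas).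
Local Notation e := (before (size gammas) tau).
Local Notation lab := (nth i0 (flatten gammas)).
Local Notation Phi := (order_sum a g e lab).

Let theta1 : 1 < beta + beta. Proof. by move: beta_half; lra. Qed.

Let tau0 : tau 0 = 0%N. Proof. by rewrite /block_end take0. Qed.

Let tau_lt_succ := block_end_incr gammas_nonempty.

Let e_irr := before_irr tau_lt_succ.

(** Just before the end of block q + 1 the order splits into the first q blocks
    and a chain. *)
Lemma order_sum_before_last q n : (q < size gammas)%N ->
  (tau q + n).+1 = tau q.+1 -> forall u, a <= u <= b ->
  Phi (iota 0 (tau q + n)) u =
  Phi (iota 0 (tau q)) u * iter_int g a (map lab (iota (tau q) n)) u.
Proof.
move=> qp nE u uab; rewrite iotaD add0n.
rewrite (order_sum_cat beta_half ab hg lab e_irr) -?iotaD ?iota_uniq//; last first.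
  move=> k l; rewrite !mem_iota add0n => /andP[_ kq] /andP[ql ln].
  by apply: (before_free tau_lt_succ qp); rewrite // -nE ltnS.
congr (_ * _); apply: (order_sum_chain beta_half ab hg lab e_irr) => //.
- exact: iota_uniq.
- apply/(pairwiseP 0%N) => i j _ + ij; rewrite inE size_iota => jn.
  rewrite !nth_iota// ?(ltn_trans ij)//.
  apply: (before_block qp); rewrite ?leq_addr ?ltn_add2l//.
  by rewrite -nE ltnS leq_add2l ltnW.
- exact: before_asym tau_lt_succ.
Qed.

(** The end of a block is the unique maximal letter of the blocks up to it, so
    the germ of [order_sum_germ] has a single term. *)
Lemma order_sum_block_germ q n : (q < size gammas)%N -> n.+1 = tau q.+1 ->
  has_germ a b (beta + beta) (Phi (iota 0 n.+1))
    (young (Phi (iota 0 n)) (fun u => g u 0 (lab n))).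
Proof.
move=> qp nE; rewrite -addn1 iotaD add0n cats1.
have mem_io k : (k \in rcons (iota 0 n) n) = (k <= n)%N.
  by rewrite mem_rcons inE mem_iota add0n [RHS]leq_eqVlt.
apply: (order_sum_top beta_half ab hg lab e_irr).
- by rewrite -cats1 -[n in [:: n]]add0n -(iotaD 0 n 1) iota_uniq.
- apply/allP => k; rewrite mem_io => kn; apply/negP => /(before_lt tau_lt_succ).
  by rewrite ltnNge kn.
- move=> x; rewrite mem_iota => /andP[_ xn].
  have [y yn xy] := before_top tau0 qp nE xn.
  by apply/allPn; exists y; rewrite ?mem_io// negbK.
Qed.

(** For q + 1 blocks, both sides start at 0 and have the germ of
    Phi(first q blocks) dg^(gamma^(q+1)): the left one by definition of
    [int_diff], the right one by the two lemmas above. *)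
Lemma iter_int_diff_order_sum q : (q <= size gammas)%N -> forall u, a <= u <= b ->
  iter_int_diff g a (take q gammas) u = Phi (iota 0 (tau q)) u.
Proof.
elim: q => [_ u _|q IH qp]; first by rewrite take0 tau0 order_sum_nil.
have {}IH := IH (ltnW qp).
rewrite (take_nth [::] qp) /iter_int_diff foldl_rcons -/(iter_int_diff _ _ _).
have := block_labels i0 qp; have := block_end_succ qp.
have := gammas_nonempty qp; case: (nth [::] gammas q) => // i w _.
rewrite (_ : size (i :: w) = (size w).+1)// addnS => tauE.
rewrite -addn1 iotaD map_cat /= cats1 lastI => /rcons_inj[wE iE].
have sw : size w = size (belast i w) by rewrite size_belast.
(* The integrand of [int_diff]; i :: w is the block q + 1. *)
pose f u := iter_int_diff g a (take q gammas) u * iter_int g a (belast i w) u.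
have fE u : a <= u <= b -> Phi (iota 0 (tau q + size w)) u = f u.
  by move=> uab; rewrite order_sum_before_last// -IH// wE.
have hf : hoelder_in a b beta f.
  by apply: hoelder_ext fE _; exact: order_sum_hoelder.
have [f0 Hf] := RSint_young beta_half ab hf (hg (last i w)).
apply: (germ_unique theta1 Hf).
- rewrite tauE; apply: germ_ext (order_sum_block_germ qp (esym tauE)) => // u v uab _.
  by rewrite /young fE// iE.
- rewrite f0 (order_sum_start beta_half ab hg lab e_irr) ?iota_uniq//.
  by rewrite -size_eq0 size_iota tauE.
Qed.

End Main.

Unset Implicit Arguments.

Theorem proposition2p10 (R : realType) (m : nat) (T beta : R)
    (g : R -> 'rV[R]_m) (hbeta : 2^-1 < beta) (hg : hoelder_on beta T g)
    (p : nat) (hp : (0 < p)%N) (gammas : p.-tuple (seq 'I_m))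
    (hgammas : forall i : 'I_p, (0 < size (tnth gammas i))%N)
    (tau s : R) (htau : 0 <= tau) (htaus : tau <= s) (hs : s <= T) :
  iter_int_diff g tau gammas s =
  \sum_(rho in Xi (total_length gammas) p (block_end gammas))
    iter_int g tau (perm_index (concat gammas) (rho^-1)%g) s.
Proof.
have i0 : 'I_m by have := hgammas (Ordinal hp); case: (tnth _ _) => [|i].
have ne q : (q < size gammas)%N -> (0 < size (nth [::] gammas q))%N.
  by rewrite size_tuple => qp; have := hgammas (Ordinal qp); rewrite (tnth_nth [::]).
have hgi i : hoelder_in tau s beta (fun u => g u 0 i).
  have [C HC] := hg; exists `|C| => // u v au uv vb.
  have v0T : 0 <= v <= T by apply/andP; split; lra.
  have u0T : 0 <= u <= T by apply/andP; split; lra.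
  rewrite -[v - u]ger0_norm ?subr_ge0//.
  apply: le_trans (_ : C * `|v - u| `^ beta <= _); last first.
    by rewrite ler_wpM2r ?powR_ge0 ?ler_norm.
  apply: le_trans (HC v u v0T u0T); have <- : (g v - g u) 0 i = g v 0 i - g u 0 i.
    by rewrite !mxE.
  rewrite [leRHS]/Num.norm/= mx_normrE.
  exact: (le_bigmax _ (fun ij => `|(g v - g u) ij.1 ij.2|) (0, i)).
have -> : iter_int_diff g tau gammas s = iter_int_diff g tau (take (size gammas) gammas) s.
  by rewrite take_size.
rewrite (iter_int_diff_order_sum hbeta htaus hgi i0 ne)// ?lexx ?htaus//.
rewrite block_end_size /order_sum.
rewrite (perm_big _ (linexts_perm_word (before_irr (block_end_incr ne))
  (@Xi_before _ _ (total_length gammas)))).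
rewrite big_map size_tuple big_enum; apply: eq_bigr => rho _.
congr (iter_int g tau _ s); rewrite /perm_index/= -map_comp.
by apply: eq_map => k; rewrite /= (tnth_nth i0).
Qed.
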